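(* Suppose there is a function $U(n,\eta)$ and a CONGEST algorithm that, given any graph $G$ on $n$ vertices and a parameter $\eta>0$, computes an $\eta$-fair fractional orientation of $G$ in $O(U(n,\eta))$ rounds. Then there exists a CONGEST algorithm that, given $\varepsilon>0$ and a value $\tilde D\le\rho^{\max}(G)$ known to every vertex, makes each vertex output a bit such that the subgraph $H$ induced by the vertices outputting $1$ satisfies $\rho(H)\ge(1-\varepsilon)\tilde D$, after $O\big(U(n,\tfrac{\varepsilon^2}{128\log n})+\tfrac{\log^2 n}{\varepsilon^2}\big)$ rounds.
   Context: CONGEST model: synchronous rounds on the communication network $G$, each vertex sending an $O(\log n)$-bit message to each neighbour per round. A fractional orientation assigns to each edge $\overline{uv}$ nonnegative reals $\textsl{g}(u\to v),\textsl{g}(v\to u)$ summing to the edge weight; out-degree $\textsl{g}(u)=\sum_v\textsl{g}(u\to v)$. It is $\eta$-fair if $\textsl{g}(u\to v)>0$ implies $\textsl{g}(u)\le(1+\eta)\textsl{g}(v)$. For a subgraph $H$, $\rho(H)=\frac{1}{|V(H)|}\sum_{e\in E(H)}\textsl{g}(e)$, and $\rho^{\max}(G)=\max_{H\subseteq G}\rho(H)$.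
   Formalization: The formal theorem takes n ≥ 2 (log n is in a denominator) and excludes ε > 1 with D̃ < 0, where the claim is false: for one edge of weight 1, ε = 2 and D̃ = −100 it would require ρ(H) ≥ 100. *)

(* Defs.v *)
From HB Require Import structures.
From mathcomp Require Import all_boot all_order all_algebra.
From mathcomp Require Import reals exp.

Set Implicit Arguments.
Unset Strict Implicit.
Unset Printing Implicit Defensive.

Import Order.TTheory GRing.Theory Num.Theory.
Local Open Scope ring_scope.

(* An edge is the two-element set of its endpoints; [weight] is meaningful on
   edges only. *)
Record wgraph (R : realType) (V : finType) := WGraph {
  edges : {set {set V}};
  weight : {set V} -> R;
  card_edge : forall e, e \in edges -> #|e| = 2%N;
  weight_gt0 : forall e, e \in edges -> 0 < weight e }.

Section Graph.
Variables (R : realType) (V : finType) (G : wgraph R V).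

(* Irreflexive, since edges have exactly two elements. *)
Definition adj : rel V := fun u v => [set u; v] \in edges G.

(* A pair (vertex set, edge set), not necessarily an induced subgraph. *)
Definition subgraph (H : {set V} * {set {set V}}) : bool :=
  [&& H.1 != set0, H.2 \subset edges G & [forall e in H.2, e \subset H.1]].

Definition density (H : {set V} * {set {set V}}) : R :=
  (\sum_(e in H.2) weight G e) / #|H.1|%:R.

(* Densities are nonnegative, so the default value 0 does not affect the
   maximum when [V] is nonempty. *)
Definition rho_max : R := \big[Num.max/0]_(H | subgraph H) density H.

Definition induced (S : {set V}) : {set V} * {set {set V}} :=
  (S, [set e in edges G | e \subset S]).

(* [g u v] is the share of the edge uv that is oriented from u to v; it is
   meaningful for adjacent u and v only. *)
Definition fractional_orientation (g : V -> V -> R) : Prop :=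
  forall u v, adj u v ->
    [/\ 0 <= g u v, 0 <= g v u & g u v + g v u = weight G [set u; v]].

Definition outdeg (g : V -> V -> R) (u : V) : R := \sum_(v | adj u v) g u v.

Definition fair (eta : R) (g : V -> V -> R) : Prop :=
  forall u v, adj u v -> 0 < g u v -> outdeg g u <= (1 + eta) * outdeg g v.

End Graph.

(* What a vertex sees initially: its own identifier and, for each identifier
   of a neighbour, the weight of the connecting edge ([None] on numbers that
   are not identifiers of neighbours). *)
Record local_view (R : realType) := LocalView {
  own_id : nat;
  incident : nat -> option R }.

(* The code run by every vertex.  [send s i] is the bit string sent in state
   [s] to the neighbour with identifier [i]; [recv s m] is the next state when
   [m i] is the message received from the neighbour with identifier [i]
   (the empty string if there is no such neighbour).  Local computation is
   unrestricted. *)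
Record program (R : realType) (Out : Type) := Program {
  state : Type;
  init : local_view R -> state;
  send : state -> nat -> seq bool;
  recv : state -> (nat -> seq bool) -> state;
  output : state -> Out }.

(* A deterministic algorithm is a family [A n p] of programs, where the number
   n of vertices and the global parameters p are known to every vertex.
   It is a CONGEST algorithm when messages have O(log n) bits, with a constant
   independent of p. *)
Definition congest (R : realType) (P Out : Type)
    (A : nat -> P -> program R Out) : Prop :=
  exists c : nat, forall n (p : P) (s : state (A n p)) (i : nat),
    (size (send s i) <= c * up_log 2 n)%N.

(* Distinct identifiers from a range of size polynomial in n. *)
Definition valid_ids (V : finType) (k : nat) (id : V -> nat) : Prop :=
  injective id /\ forall v, (id v < #|V| ^ k)%N.

Section Execution.
Variables (R : realType) (V : finType) (G : wgraph R V) (id : V -> nat).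
Variables (Out : Type) (A : program R Out).

Definition neighbour (v : V) (i : nat) : option V :=
  [pick u | adj G v u && (id u == i)].

Definition view (v : V) : local_view R :=
  LocalView (id v)
    (fun i => omap (fun u => weight G [set v; u]) (neighbour v i)).

Definition round (st : V -> state A) : V -> state A := fun v =>
  recv (st v)
    (fun i => oapp (fun u => send (st u) (id v)) [::] (neighbour v i)).

Definition run (t : nat) : V -> state A :=
  iter t round (fun v => init A (view v)).

Definition result (t : nat) (v : V) : Out := output (run t v).

End Execution.

(* The orientation described by the local outputs: u outputs, as a function of
   the identifiers of its neighbours, the shares of its outgoing edges. *)
Definition oriented_by (R : realType) (V : finType) (id : V -> nat)
    (o : V -> nat -> R) : V -> V -> R := fun u v => o u (id v).

Definition log2 (R : realType) (n : nat) : R := ln n%:R / ln 2.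

(* Main.v *)
(* If g is eta-fair, then a vertex reached from u along j positively oriented
   edges has out-degree at least (1 - j eta) g(u).  Hence around a vertex u with
   g(u) >= D the out-balls B_i of radius i < L, where L = O(log n / eps), consist
   of vertices of out-degree close to D, and all the weight they send out stays
   inside B_(i+1).  As |B_i| cannot grow by a factor 1 + eps/2 in each of L
   steps, some B_(i+1) has density at least (1 - eps) D.

   To do this distributively, the heavy vertices flood their identifiers for 2L
   rounds, and those which see no larger identifier become centers; the
   out-balls of radius L around distinct centers are disjoint and no positive
   edge leads from one to another, so the union of one good ball per center is
   again dense.  A breadth-first search along positive edges gives each center a
   tree; in round j every vertex sends its parent the number of its descendants
   j levels below, so that after L rounds each center knows the sizes of its
   balls, picks a radius, and announces it by a wave down its tree. *)
Require Import Defs.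
From HB Require Import structures.
From mathcomp Require Import all_boot all_order all_algebra.
From mathcomp Require Import boolp reals exp.
From mathcomp Require Import zify ring lra.

Set Implicit Arguments.
Unset Strict Implicit.
Unset Printing Implicit Defensive.

Import Order.TTheory GRing.Theory Num.Theory.
Local Open Scope ring_scope.

(** * Edge weights as sums of oriented shares *)

Section EdgeSums.
Variables (R : realType) (V : finType) (G : wgraph R V).

Lemma adjC : symmetric (adj G).
Proof. by move=> u v; rewrite /adj setUC. Qed.

Lemma adj_neq u v : adj G u v -> u != v.
Proof. by move/card_edge; rewrite cards2; case: eqP. Qed.

Variable g : V -> V -> R.
Hypothesis g_or : fractional_orientation G g.

Lemma orientation_ge0 u v : adj G u v -> 0 <= g u v.
Proof. by move/g_or=> []. Qed.

(** Each edge inside [S] comes from exactly two ordered pairs, (a, b) and (b, a), whose shares add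
    up to its weight. *)
Lemma sum_orientation (S : {set V}) :
  \sum_(e in (induced G S).2) weight G e =
  \sum_(u in S) \sum_(v in S | adj G u v) g u v.
Proof.
rewrite pair_big_dep /=.
rewrite (partition_big (fun p => [set p.1; p.2])
  (fun e => e \in (induced G S).2)) /=; last first.
  move=> [u v] /= /andP[uS /andP[vS uv]].
  by rewrite inE [_ \in edges G]uv subUset !sub1set uS.
apply: eq_bigr => e; rewrite inE => /andP[eE eS].
have /cards2P[a [b [ab eab]]] : #|e| == 2%N by rewrite (card_edge eE).
move: eE eS; rewrite {e}eab => eE; have adj_ab : adj G a b := eE.
rewrite subUset !sub1set => /andP[aS bS].
rewrite (bigD1 (a, b)) /= ?aS ?bS ?adj_ab ?eqxx //.
rewrite (bigD1 (b, a)) /=; last first.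
  by rewrite aS bS adjC adj_ab setUC eqxx /= xpair_eqE negb_and eq_sym ab.
rewrite big1 ?addr0 => [|[x y] /=]; first by case: (g_or adj_ab).
rewrite !xpair_eqE => /andP[/andP[/andP[/andP[xS /andP[yS /adj_neq xy]] /eqP xyab]]].
have := set21 x y; have := set22 x y; rewrite xyab !inE.
by move=> /orP[]/eqP ? /orP[]/eqP ?; subst; rewrite ?eqxx ?andbF //= in xy *.
Qed.

(** The shares that a vertex of [X] sends outside [S] vanish, so its whole out-degree lies on edges
    inside [S]. *)
Lemma sum_outdeg_le (X S : {set V}) : X \subset S ->
    (forall x y, x \in X -> adj G x y -> 0 < g x y -> y \in S) ->
  \sum_(x in X) outdeg G g x <= \sum_(e in (induced G S).2) weight G e.
Proof.
move=> XS Xout; rewrite sum_orientation.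
rewrite [leRHS](big_setID X) /= (setIidPr XS) ler_wpDr //.
  by apply: sumr_ge0 => u _; apply: sumr_ge0 => v /andP[_ /orientation_ge0].
apply: ler_sum => x xX; rewrite /outdeg (bigID (mem S)) /=.
rewrite [X in _ + X]big1 ?addr0 => [|y /andP[xy yS]].
  by rewrite le_eqVlt; apply/orP; left; apply/eqP/eq_bigl => y; rewrite andbC.
apply/eqP; rewrite eq_le orientation_ge0 // andbT leNgt.
by apply: contra yS; apply: Xout.
Qed.

(** Averaging: a subgraph weighs at most the sum of the out-degrees of its vertices, so out-degrees
    all below [D] force every density below [D]. *)
Lemma exists_outdeg_ge (D : R) :
  0 < D -> D <= rho_max G -> exists v, D <= outdeg G g v.
Proof.
move=> D0 Drho; apply/existsP; apply/contraT => /existsPn outD.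
suff : rho_max G < D by rewrite ltNge Drho.
(* Positivity of [D] covers the default value 0 of the maximum. *)
rewrite /rho_max; apply: (big_ind (fun x => x < D)) => //
  [x y xD yD|H /and3P[H0 HE HS]].
  by rewrite gt_max xD.
rewrite /density ltr_pdivrMr ?ltr0n ?card_gt0 //.
apply: (@le_lt_trans _ _ (\sum_(v in H.1) outdeg G g v)); last first.
  rewrite -[#|H.1|]sum1_card natr_sum mulr_sumr.
  case/set0Pn: H0 => x xH; rewrite (bigD1 x) //= [ltRHS](bigD1 x) //= !mulr1.
  rewrite ltr_leD ?ltNge ?outD //.
  apply: ler_sum => y _; rewrite ?mulr1 leNgt; apply/negP => /ltW Dy.
  by case/negP: (outD y).
apply: (@le_trans _ _ (\sum_(e in (induced G H.1).2) weight G e)).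
  rewrite [leRHS](big_setID H.2) /= (_ : _ :&: _ = H.2) ?ler_wpDr //.
    by apply: sumr_ge0 => e /setDP[]; rewrite inE => /andP[/weight_gt0/ltW].
  apply/setIidPr/subsetP => e eH; rewrite inE (subsetP HE _ eH).
  exact: (forall_inP HS).
rewrite sum_orientation; apply: ler_sum => u _.
rewrite /outdeg [leRHS](bigID (mem H.1)) /= ler_wpDr //.
  by apply: sumr_ge0 => v /andP[/orientation_ge0].
by rewrite le_eqVlt; apply/orP; left; apply/eqP/eq_bigl => y; rewrite andbC.
Qed.

End EdgeSums.

(** * Forests of parent pointers and the balls around their roots *)

Section Forest.
Variables (V : finType) (par : V -> option V).

Fixpoint chain (j : nat) (w u : V) : bool :=
  if j is j'.+1 then oapp (fun w' => chain j' w' u) false (par w) else w == u.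

Definition depth_card (j : nat) (u : V) : nat := #|[pred w | chain j w u]|.

Lemma depth_card0 u : depth_card 0 u = 1%N.
Proof. by rewrite /depth_card (eq_card (B := pred1 u)) ?card1. Qed.

(** The definition splits off the first step, at [w]; counting descendants needs the last one, from
    a child of [u]. *)
Lemma chainSr j w u :
  chain j.+1 w u = [exists v, chain j w v && (par v == Some u)].
Proof.
elim: j w => [|j IHj] w.
  rewrite /=; apply/idP/existsP => [|[v /andP[/eqP-> /eqP->]] /=]; last by [].
  by case E: (par w) => [w'|] //= /eqP<-; exists w; rewrite eqxx E /=.
rewrite [LHS]/=; case E: (par w) => [w'|]; last first.
  by apply/esym/existsP => -[v]; rewrite /= E.
rewrite [LHS]IHj /=; apply: eq_existsb => v; by rewrite E.
Qed.

Lemma chain_det j w u v : chain j w u -> chain j w v -> u = v.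
Proof.
elim: j w => [|j IHj] w /=; first by move/eqP<- => /eqP.
by case: (par w) => //=.
Qed.

(** A descendant [j + 1] levels below [u] lies [j] levels below exactly one child of [u]. The
    counting phase runs this recursion. *)
Lemma depth_cardS j u :
  depth_card j.+1 u = (\sum_(v | par v == Some u) depth_card j v)%N.
Proof.
rewrite /depth_card; under eq_bigr do rewrite -sum1_card.
rewrite (exchange_big_dep predT) //= -sum1_card big_mkcond /=.
apply: eq_bigr => w _; rewrite sum1_card inE -/(chain j.+1 w u) chainSr.
case: existsP => [[v wv]|nwu]; last first.
  rewrite (eq_card0 (A := [pred v | _])) // => v; rewrite !inE.
  by apply/negP => /andP[? ?]; apply: nwu; exists v; apply/andP.
rewrite (eq_card1 (x := v)) // => v1; rewrite !inE [LHS]/(_ && _) inE.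
case/andP: wv => wv vu; apply/andP/eqP => [[_ /(chain_det wv)->]|->]; [by []|by []].
Qed.

Lemma depth_card_le j u : (depth_card j u <= #|V|)%N.
Proof. exact: max_card. Qed.

Variable Cen : {set V}.
Hypothesis par_center : forall u, u \in Cen -> par u = None.

(** No chain continues past a center, so both chains from [w] stop at the same place. *)
Lemma chain_center_uniq j j' w u u' : u \in Cen -> u' \in Cen ->
  chain j w u -> chain j' w u' -> j = j' /\ u = u'.
Proof.
move=> uC u'C; elim: j j' w => [|j IHj] [|j'] w /=.
- by move=> /eqP<- /eqP.
- by move=> /eqP->; rewrite par_center.
- by move=> + /eqP E; rewrite E par_center.
by case: (par w) => //= w' /IHj/[apply] -[->].
Qed.

Variable r : V -> nat.

Definition cluster : {set V} :=
  [set w | [exists u in Cen, exists j : 'I_(r u).+1, chain j w u]].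

Lemma clusterP w :
  reflect (exists u j, [/\ u \in Cen, (j <= r u)%N & chain j w u])
          (w \in cluster).
Proof.
rewrite inE; apply: (iffP exists_inP) => [[u uC /existsP[j wu]]|[u [j [uC jr wu]]]].
  by exists u, j; rewrite -ltnS ltn_ord.
by exists u => //; apply/existsP; exists (Ordinal (jr : (j < (r u).+1)%N)).
Qed.

Lemma card_cluster :
  #|cluster| = (\sum_(u in Cen) \sum_(j < (r u).+1) depth_card j u)%N.
Proof.
(* [h w] counts the pairs (center, level) that contain [w]; by uniqueness it is 1 on the cluster and
   0 off it. *)
pose h w := (\sum_(u in Cen) \sum_(j < (r u).+1) chain j w u)%N.
transitivity (\sum_w h w)%N; last first.
  rewrite exchange_big; apply: eq_bigr => u _.
  rewrite exchange_big; apply: eq_bigr => j _.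
  rewrite /depth_card -sum1_card [RHS]big_mkcond; apply: eq_bigr => w _.
  by rewrite inE; case: chain.
rewrite -sum1_card big_mkcond; apply: eq_bigr => w _.
case: clusterP => [[u [j [uC jr wu]]]|nw]; rewrite /h.
  rewrite (bigD1 u) //= (bigD1 (Ordinal (jr : (j < (r u).+1)%N))) //= wu.
  rewrite big1 ?addn0 => [|i ij]; last first.
    apply/eqP; rewrite eqb0; apply/negP => wi.
    by case: (chain_center_uniq uC uC wu wi) => E; case/eqP: ij; apply: val_inj.
  rewrite big1 // => u' /andP[u'C uu']; rewrite big1 // => i _.
  apply/eqP; rewrite eqb0; apply/negP => wi.
  by case: (chain_center_uniq uC u'C wu wi) uu' => _ ->; rewrite eqxx.
rewrite big1 // => u uC; rewrite big1 // => i _; apply/eqP; rewrite eqb0.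
by apply/negP => wi; apply: nw; exists u, i; rewrite -ltnS ltn_ord.
Qed.

End Forest.

(** The ball around a root is the cluster whose only center is that root. *)
Lemma sum_depth_card_le (V : finType) (par : V -> option V) u i :
  par u = None -> (\sum_(j < i.+1) depth_card par j u <= #|V|)%N.
Proof.
move=> pu.
have h v : v \in [set u] -> par v = None by rewrite inE => /eqP->.
have := card_cluster h (fun=> i); rewrite big_set1 => <-; exact: max_card.
Qed.

Lemma chain_mono (V : finType) (par par' : V -> option V) :
  (forall v w, par v = Some w -> par' v = Some w) ->
  forall j w u, chain par j w u -> chain par' j w u.
Proof.
move=> pp; elim=> [|j IHj] w u //=.
by case E: (par w) => [w'|] //= /IHj; rewrite (pp _ _ E).
Qed.

(** * Slow steps in the growth of a ball *)

Lemma bernoulli (R : realType) (x : R) n : 0 <= x -> 1 + n%:R * x <= (1 + x) ^+ n.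
Proof.
move=> x0; elim: n => [|n IHn]; first by rewrite mul0r addr0.
rewrite exprSr; apply: (@le_trans _ _ ((1 + n%:R * x) * (1 + x))); last first.
  by apply: ler_wpM2r => //; rewrite addr_ge0.
have := mulr_ge0 (mulr_ge0 (ler0n R n) x0) x0.
rewrite -natr1; nra.
Qed.

(** As [(1 + x) ^ m >= 1 + m x >= 2], fast growth in the first [m * l] steps gives a size of at
    least [2 ^ l >= n]; one more fast step would exceed [n]. *)
Lemma slow_growth (R : realType) (x : R) (m l n : nat) (N : nat -> nat) :
    0 < x -> 1 <= m%:R * x -> (n <= 2 ^ l)%N ->
    N 0%N = 1%N -> (forall i, N i <= n)%N ->
  has (fun i => (N i.+1)%:R <= (1 + x) * (N i)%:R) (iota 0 (m * l).+1).
Proof.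
move=> x0 mx nl N0 Nn; apply/contraT; rewrite -all_predC => /allP fast.
have {}fast i : (i < (m * l).+1)%N -> (1 + x) * (N i)%:R < (N i.+1)%:R.
  by move=> iL; rewrite ltNge; apply: (fast i); rewrite mem_iota.
have big i : (i <= (m * l).+1)%N -> (1 + x) ^+ i <= (N i)%:R.
  elim: i => [|i IHi] iL; first by rewrite N0.
  rewrite exprS; apply: le_trans (ltW (fast i iL)).
  by apply: ler_wpM2l; [lra|apply: IHi; lia].
have := fast _ (ltnSn _); have := big _ (leqnSn (m * l)).
have : n%:R <= (1 + x) ^+ (m * l).
  apply: (@le_trans _ _ ((2 ^ l)%N%:R)); first by rewrite ler_nat.
  rewrite exprM natrX lerXn2r ?nnegrE //.
    by rewrite exprn_ge0 //; lra.
  by have := bernoulli m (ltW x0); lra.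
have : (N (m * l).+1)%:R <= n%:R :> R by rewrite ler_nat.
move: ((1 + x) ^+ _) => y b_le n_le y_le lt_b.
have := mulr_ge0 (ltW x0) (ler0n R (N (m * l)%N)).
lra.
Qed.

(** * Messages as bit strings, and composition of stages *)

Fixpoint encode (w x : nat) : seq bool :=
  if w is w'.+1 then odd x :: encode w' x./2 else [::].

(** The empty string decodes to 0, so an absent neighbour counts as one that sends no message. *)
Definition decode (s : seq bool) : nat :=
  foldr (fun (b : bool) x => (b + x.*2)%N) 0%N s.

Lemma size_encode w x : size (encode w x) = w.
Proof. by elim: w x => //= w IHw x; rewrite IHw. Qed.

Lemma encodeK w x : (x < 2 ^ w)%N -> decode (encode w x) = x.
Proof.
elim: w x => [|w IHw] x; first by case: x.
rewrite expnS mul2n => xw /=; rewrite IHw ?odd_double_half //.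
by rewrite -ltn_double -[X in (_ < X)%N]add0n; have := odd_double_half x; lia.
Qed.

(** Unlike a [program], a stage takes an input besides the local view, which lets the output of one
    stage feed the next. *)
Record stage (R : realType) (X Y : Type) := Stage {
  sstate : Type;
  sinit : local_view R -> X -> sstate;
  ssend : sstate -> nat -> seq bool;
  srecv : sstate -> (nat -> seq bool) -> sstate;
  sout : sstate -> Y }.

(* A stage whose messages are numbers, 0 standing for no message; the view and
   the input stay available throughout. *)
Record nstage (R : realType) (X Y : Type) := NStage {
  nstate : Type;
  ninit : local_view R -> X -> nstate;
  nsend : local_view R -> X -> nstate -> nat -> nat;
  nrecv : local_view R -> X -> nstate -> (nat -> nat) -> nstate;
  nout : local_view R -> X -> nstate -> Y }.

Section Stages.
Variable R : realType.

Definition bounded (X Y : Type) (b : nat) (P : stage R X Y) :=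
  forall (s : sstate P) i, (size (ssend s i) <= b)%N.

Definition of_program (Y : Type) (P : program R Y) : stage R unit Y :=
  Stage (fun lv (_ : unit) => init P lv) (@send _ _ P) (@recv _ _ P)
        (@output _ _ P).

Definition to_program (Y : Type) (P : stage R unit Y) : program R Y :=
  Program (fun lv => sinit P lv tt) (@ssend _ _ _ P) (@srecv _ _ _ P)
          (@sout _ _ _ P).

Definition of_nstage (X Y : Type) (w : nat) (P : nstage R X Y) :
    stage R X Y :=
  @Stage R X Y (local_view R * X * nstate P)%type
    (fun lv x => (lv, x, ninit P lv x))
    (fun s i => encode w (nsend s.1.1 s.1.2 s.2 i))
    (fun s m => (s.1, nrecv s.1.1 s.1.2 s.2 (fun i => decode (m i))))
    (fun s => nout s.1.1 s.1.2 s.2).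

Section Seq.
Variables (X Y Z : Type) (P : stage R X Y) (t : nat) (Q : stage R Y Z).

(** The counter holds the rounds left to [P]. At 0 the vertex enters [Q] within the same round, so
    no round is lost. *)
Definition switch (lv : local_view R) (c : nat) (p : sstate P) :
    local_view R * nat * sstate P + sstate Q :=
  if c is 0 then inr (sinit Q lv (sout p)) else inl (lv, c, p).

Variable z0 : Z.

Definition seq_stage : stage R X Z :=
  @Stage R X Z (local_view R * nat * sstate P + sstate Q)%type
    (fun lv x => switch lv t (sinit P lv x))
    (fun s i => match s with inl (_, _, p) => ssend p i
                           | inr q => ssend q i end)
    (fun s m => match s with inl (lv, c, p) => switch lv c.-1 (srecv p m)
                           | inr q => inr (srecv q m) end)
    (fun s => match s with inl _ => z0 | inr q => sout q end).

Lemma bounded_seq b : bounded b P -> bounded b Q -> bounded b seq_stage.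
Proof. by move=> bP bQ [[[lv c] p]|q] i /=; [apply: bP|apply: bQ]. Qed.

End Seq.

Section Run.
Variables (V : finType) (G : wgraph R V) (id : V -> nat).

Definition sround (X Y : Type) (P : stage R X Y) (st : V -> sstate P) v :=
  srecv (st v)
    (fun i => oapp (fun u => ssend (st u) (id v)) [::] (neighbour G id v i)).

Definition srun (X Y : Type) (P : stage R X Y) (x : V -> X) (t : nat) :=
  iter t (@sround X Y P) (fun v => sinit P (view G id v) (x v)).

Definition sresult (X Y : Type) (P : stage R X Y) (x : V -> X) t v :=
  sout (srun P x t v).

Lemma result_to_program Y (P : stage R unit Y) t :
  result G id (to_program P) t = sresult P (fun=> tt) t.
Proof. by []. Qed.

Lemma sresult_of_program Y (P : program R Y) t :
  sresult (of_program P) (fun=> tt) t = result G id P t.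
Proof. by []. Qed.

(** All vertices count down from the same [t], hence switch together, and the dummy output [z0] is
    no longer visible. *)
Lemma sresult_seq X Y Z (P : stage R X Y) t (Q : stage R Y Z) z0 x s :
  sresult (seq_stage P t Q z0) x (t + s) = sresult Q (sresult P x t) s.
Proof.
set S := seq_stage P t Q z0.
have run1 k : (k <= t)%N -> srun S x k =
    (fun v => switch Q (view G id v) (t - k) (srun P x k v)).
  elim: k => [|k IHk] kt; first by rewrite subn0.
  rewrite [LHS]/= -/(srun S x k) IHk ?(ltnW kt) //; apply/funext => v.
  rewrite /sround /= subnS; case E: (t - k)%N => [|c]; first by lia.
  by [].
suff run2 : srun S x (t + s) = (fun v => inr (srun Q (sresult P x t) s v)).
  by apply/funext => v; rewrite /sresult run2.
elim: s => [|s IHs]; first by rewrite addn0 run1 // subnn.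
by rewrite addnS [LHS]/= -/(srun S x _) IHs.
Qed.

Definition nround (X Y : Type) (P : nstage R X Y) (x : V -> X)
    (st : V -> nstate P) v :=
  nrecv (view G id v) (x v) (st v)
    (fun i => oapp (fun u => nsend (view G id u) (x u) (st u) (id v)) 0%N
                   (neighbour G id v i)).

Definition nrun (X Y : Type) (P : nstage R X Y) (x : V -> X) (t : nat) :=
  iter t (@nround X Y P x) (fun v => ninit P (view G id v) (x v)).

Definition nresult (X Y : Type) (P : nstage R X Y) (x : V -> X) t v :=
  nout (view G id v) (x v) (nrun P x t v).

Lemma nrunS X Y (P : nstage R X Y) x t v :
  nrun P x t.+1 v =
  nrecv (view G id v) (x v) (nrun P x t v)
    (fun i => oapp (fun u => nsend (view G id u) (x u) (nrun P x t u) (id v))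
                   0%N (neighbour G id v i)).
Proof. by []. Qed.

(** Strings have length [w] in every state, as the CONGEST bound demands; the numbers need to fit
    only in states of the actual run. *)
Lemma sresult_of_nstage X Y w (P : nstage R X Y) x t :
    (forall s u i, (s < t)%N ->
      (nsend (view G id u) (x u) (nrun P x s u) i < 2 ^ w)%N) ->
  sresult (of_nstage w P) x t = nresult P x t.
Proof.
move=> small.
suff run s : (s <= t)%N -> srun (of_nstage w P) x s =
    (fun v => (view G id v, x v, nrun P x s v)).
  by apply/funext => v; rewrite /sresult run.
elim: s => [|s IHs] st //.
rewrite [LHS]/= -/(srun (of_nstage w P) x s) IHs ?(ltnW st) //.
apply/funext => v; rewrite /sround nrunS /=; congr (_, nrecv _ _ _ _).
apply/funext => i; case: neighbour => //= u; exact/encodeK/small.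
Qed.

End Run.
End Stages.

(** * Neighbours seen through their identifiers *)

Section Neighbours.
Variables (R : realType) (V : finType) (G : wgraph R V) (id : V -> nat).
Variable N : nat.
Hypotheses (id_inj : injective id) (id_lt : forall v, (id v < N)%N).

Lemma neighbourP v i u :
  neighbour G id v i = Some u <-> adj G v u /\ id u = i.
Proof.
rewrite /neighbour; case: pickP => [w /andP[vw /eqP wi]|none].
  by split=> [[<-]|[_ ui]] //; congr Some; apply: id_inj; rewrite ui.
by split=> // -[vu ui]; have := none u; rewrite vu ui eqxx.
Qed.

Lemma neighbour_id v u : adj G v u -> neighbour G id v (id u) = Some u.
Proof. by move=> vu; apply/neighbourP. Qed.

(** A vertex can only range over identifiers below [N]; those of non-neighbours contribute the
    neutral element. *)
Lemma big_neighbour (T : Type) (idx : T) (op : Monoid.com_law idx)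
    (f : V -> T) v :
  \big[op/idx]_(i < N) oapp f idx (neighbour G id v i) =
  \big[op/idx]_(u | adj G v u) f u.
Proof.
rewrite [RHS](partition_big (fun u => Ordinal (id_lt u)) predT) //=.
apply: eq_bigr => i _; case E: (neighbour G id v i) => [u|] /=.
  move/neighbourP: E => [vu ui]; rewrite (big_pred1 u) // => u' /=.
  rewrite -val_eqE /= -ui; apply/andP/eqP => [[_ /eqP /id_inj]|->] //.
rewrite big_pred0 // => u; apply/negP => /andP[vu /eqP ui].
by move: E; rewrite -ui /= neighbour_id.
Qed.

End Neighbours.

(** * The four phases run after the orientation is computed *)

Section Phases.
Variables (R : realType) (N L : nat) (D x : R).

Definition heavy (lv : local_view R) (o : nat -> R) : bool :=
  D <= \sum_(i < N) oapp (fun=> o i) 0 (incident lv i).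

(** Flooded identifiers are shifted by one, leaving 0 for no heavy vertex seen so far. *)
Definition elect : nstage R (nat -> R) ((nat -> R) * bool) :=
  @NStage R (nat -> R) ((nat -> R) * bool) nat
    (fun lv o => if heavy lv o then (own_id lv).+1 else 0%N)
    (fun _ _ s _ => s)
    (fun _ _ s msg => maxn s (\max_(i < N) msg i))
    (fun lv o s => (o, heavy lv o && (s == (own_id lv).+1))).

(* State: whether the vertex has been reached, and from which neighbour. *)
Definition grow : nstage R ((nat -> R) * bool) (bool * option nat) :=
  @NStage R ((nat -> R) * bool) (bool * option nat) (bool * option nat)
    (fun _ a => (a.2, None))
    (fun _ a s i => s.1 && (0 < a.1 i) : nat)
    (fun _ _ s msg =>
       if s.1 then s
       else if [pick i : 'I_N | (0 < msg i)%N] is Some i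
            then (true, Some (val i)) else s)
    (fun _ a s => (a.2, s.2)).

Definition ball_size (h : seq nat) (i : nat) : nat :=
  (\sum_(j < i.+1) nth 0 h j)%N.

(** The successor selects the outer ball of the first slow step, the one that receives all weight
    sent out by the inner ball. *)
Definition radius (h : seq nat) : nat :=
  (find (fun i => (ball_size h i.+1)%:R <= (1 + x) * (ball_size h i)%:R)
        (iota 0 L)).+1.

(* After t rounds a vertex knows how many of its descendants are exactly j
   levels below it, for each j <= t. *)
Definition count_levels :
    nstage R (bool * option nat) (option nat * option nat) :=
  @NStage R (bool * option nat) (option nat * option nat) (seq nat)
    (fun _ _ => [:: 1%N])
    (fun _ a h i => if a.2 == Some i then last 0%N h else 0%N)
    (fun _ _ h msg => rcons h (\sum_(i < N) msg i)%N)
    (fun _ a h => (if a.1 then Some (radius h) else None, a.2)).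

(* A center of radius r wakes up in round L - r: the wave, stopped in round L,
   then travels r levels without carrying a counter. *)
Definition mark : nstage R (option nat * option nat) bool :=
  @NStage R (option nat * option nat) bool (bool * nat)
    (fun _ a => (if a.1 is Some r then (L <= r)%N else false, 0%N))
    (fun _ _ s _ => s.1 : nat)
    (fun _ a s msg =>
       ([|| s.1, if a.2 is Some i then (0 < msg i)%N else false
          | if a.1 is Some r then (L <= r + s.2.+1)%N else false], s.2.+1))
    (fun _ _ s => s.1).

End Phases.

(** * What the phases compute *)

Section PhaseRuns.
Variables (R : realType) (V : finType) (G : wgraph R V) (id : V -> nat).
Variables (N L : nat) (D x : R).
Hypotheses (id_inj : injective id) (id_lt : forall v, (id v < N)%N).

Section Elect.
Variable o : V -> nat -> R.
Let g := oriented_by id o.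

Lemma heavyE v : heavy N D (view G id v) (o v) = (D <= outdeg G g v).
Proof.
rewrite /outdeg -(big_neighbour G id_inj id_lt) /heavy; congr (_ <= _).
apply: eq_bigr => i _ /=; case E: (neighbour G id v i) => [u|] //=.
by move/(neighbourP G id_inj): E => [_ <-].
Qed.

Definition elected t v : nat := nrun G id (elect N D) o t v.
Local Notation s := elected.

Lemma elect0 v : s 0 v = if D <= outdeg G g v then (id v).+1 else 0%N.
Proof. by rewrite -heavyE. Qed.

Arguments elected : simpl never.

Lemma electS t v : s t.+1 v = maxn (s t v) (\max_(u | adj G v u) s t u).
Proof. by rewrite -(big_neighbour G id_inj id_lt). Qed.

Lemma elect_homo t t' v : (t <= t')%N -> (s t v <= s t' v)%N.
Proof.
elim: t' => [|t' IHt']; first by rewrite leqn0 => /eqP->.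
rewrite leq_eqVlt => /predU1P[->//|/IHt' tt'].
by rewrite electS (leq_trans tt') ?leq_maxl.
Qed.

Lemma elect_adj t v u : adj G v u -> (s t u <= s t.+1 v)%N.
Proof. by move=> vu; rewrite electS leq_max orbC (leq_bigmax_cond _ vu). Qed.

Lemma elect_le t v M :
  (forall u, D <= outdeg G g u -> (id u < M)%N) -> (s t v <= M)%N.
Proof.
move=> idM; elim: t v => [|t IHt] v; first by rewrite elect0; case: ifP => // /idM.
by rewrite electS geq_max IHt; apply/bigmax_leqP.
Qed.

(** Flooding ignores the orientation, so values travel both up and down a chain, one step per
    round. *)
Lemma elect_chain (par : V -> option V) :
    (forall v w, par v = Some w -> adj G v w) ->
  forall j w u t, chain par j w u ->
    (s t w <= s (t + j) u)%N /\ (s t u <= s (t + j) w)%N.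
Proof.
move=> par_adj; elim=> [|j IHj] w u t; first by move=> /eqP->; rewrite addn0.
rewrite /=; case E: (par w) => [w'|] //= wu; have ww' := par_adj _ _ E; split.
  rewrite addnS -addSn; apply: leq_trans (IHj _ _ _ wu).1.
  by apply: elect_adj; rewrite adjC.
by rewrite addnS; apply: leq_trans (IHj _ _ _ wu).2 (elect_adj _ ww').
Qed.

Definition centers (T : nat) : {set V} :=
  [set v | (D <= outdeg G g v) && (s T v == (id v).+1)].

Lemma nresult_elect T v :
  nresult G id (elect N D) o T v = (o v, v \in centers T).
Proof. by rewrite inE -heavyE. Qed.

Lemma centersP T v : v \in centers T -> D <= outdeg G g v.
Proof. by rewrite inE => /andP[]. Qed.

(** The heavy vertex of largest identifier never sees a larger one. *)
Lemma centers_neq0 T v : D <= outdeg G g v -> centers T != set0.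
Proof.
move=> Dv; case: (@arg_maxnP _ v (fun v => D <= outdeg G g v) id Dv) => u Du umax.
apply/set0Pn; exists u; rewrite inE Du eqn_leq elect_le //=.
by rewrite (leq_trans _ (elect_homo u (leq0n T))) // elect0 Du.
Qed.

(** The two chains and the edge [w w'] form a path of length [i + 1 + j <= T], along which each
    center hears the identifier of the other; neither may be larger. *)
Lemma centers_far (par : V -> option V) T :
    (forall v w, par v = Some w -> adj G v w) ->
  forall u u' i j w w', u \in centers T -> u' \in centers T ->
    chain par i w u -> chain par j w' u' -> adj G w w' -> (i + j < T)%N ->
  u = u'.
Proof.
move=> par_adj; pose e := elect_chain par_adj.
suff le u u' i j w w' : u \in centers T -> u' \in centers T ->
    chain par i w u -> chain par j w' u' -> adj G w w' -> (i + j < T)%N ->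
    (id u <= id u')%N.
  move=> u u' i j w w' uC u'C wu w'u' ww' ij; apply: id_inj; apply/eqP.
  rewrite eqn_leq (le u u' i j w w') //=.
  by apply: (le u' u j i w' w); rewrite 1?adjC 1?addnC.
move=> uC u'C wu w'u' ww' ij; rewrite -ltnS.
move: u'C uC; rewrite !inE => /andP[_ /eqP <-] /andP[Du _].
have -> : (id u).+1 = s 0 u by rewrite elect0 Du.
apply: leq_trans (e _ _ _ _ wu).2 _; rewrite add0n.
apply: leq_trans (elect_adj i (_ : adj G w' w)) _; first by rewrite adjC.
by apply: leq_trans (e _ _ _ _ w'u').1 (elect_homo _ _).
Qed.

End Elect.

Section Grow.
Variables (o : V -> nat -> R) (C : {set V}).
Let g := oriented_by id o.
Definition grown t v : bool * option nat :=
  nrun G id (grow R N) (fun v => (o v, v \in C)) t v.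
Local Notation s := grown.

Definition parent (a : V -> option nat) (v : V) : option V :=
  obind (neighbour G id v) (a v).

Arguments grown : simpl never.

Lemma growS t v : s t.+1 v =
  if (s t v).1 then s t v
  else if [pick i : 'I_N | (0 < oapp (fun u => (s t u).1 && (0 < g u v)%R : nat)
                                0 (neighbour G id v i))%N] is Some i
       then (true, Some (val i)) else s t v.
Proof. by []. Qed.

Let p t : V -> option V := parent (fun v => (s t v).2).

Lemma grow_stable t v : (s t v).1 -> s t.+1 v = s t v.
Proof. by move=> stv; rewrite growS stv. Qed.

Lemma grow_step t u v :
  adj G u v -> 0 < g u v -> (s t u).1 -> (s t.+1 v).1.
Proof.
move=> uv guv stu; rewrite growS; case E: (s t v).1 => //.
case: pickP => // /(_ (Ordinal (id_lt u))) /=.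
by rewrite neighbour_id // 1?adjC //= stu guv.
Qed.

Lemma grow_reached t v : (s t v).2 != None -> (s t v).1.
Proof.
elim: t => // t; rewrite growS; case: ifP => // _ IHt.
by case: pickP => //= _ /IHt.
Qed.

Lemma grow_parentS t v w : p t v = Some w -> p t.+1 v = Some w.
Proof.
rewrite /p /parent; case E: (s t v).2 => [i|] //=.
have st : (s t v).1 by apply: grow_reached; rewrite E.
by rewrite grow_stable // E.
Qed.

Lemma grow_parent_le t t' v w :
  (t <= t')%N -> p t v = Some w -> p t' v = Some w.
Proof.
move=> /subnK <-; elim: (t' - t)%N => // d IHd /IHd.
by rewrite addSn; apply: grow_parentS.
Qed.

Lemma grow_parent t v w : p t v = Some w -> adj G w v /\ 0 < g w v.
Proof.
elim: t => // t IHt; rewrite /p /parent growS.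
case: ifP => // _; case: pickP => //= i; case E: neighbour => [u|] //=.
move=> /[swap] -[<-]; move/(neighbourP G id_inj): E => [vu _].
by rewrite lt0b => /andP[_ ->]; rewrite adjC.
Qed.

Lemma grow_center t v : v \in C -> p t v = None.
Proof.
move=> vC; suff: s t v = (true, None) by rewrite /p /parent => ->.
elim: t => [|t IHt]; first by rewrite /s /= vC.
by rewrite grow_stable IHt.
Qed.

(** The neighbour that first reached [v] was itself reached a round earlier, and its chain survives
    because parents never change. *)
Lemma grow_chain t v :
  (s t v).1 -> exists j u, [/\ u \in C, (j <= t)%N & chain (p t) j v u].
Proof.
elim: t v => [|t IHt] v; first by move=> vC; exists 0%N, v; split=> //=.
have up w : (s t w).1 ->
    exists j u, [/\ u \in C, (j <= t)%N & chain (p t.+1) j w u].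
  move=> /IHt[j [u [uC jt wu]]]; exists j, u; split=> //.
  by apply: chain_mono wu => v' w'; apply: grow_parentS.
case E: (s t v).1.
  move=> _; case: (up _ E) => j [u [uC jt vu]]; exists j, u.
  by split; rewrite // leqW.
case P : (p t.+1 v) => [w|] st1.
  suff /up[j [u [uC jt wu]]] : (s t w).1 by exists j.+1, u; split; rewrite //= P.
  move: P; rewrite /p /parent growS E; case: pickP => [i|] /=.
    case: neighbour => [u|] //= /[swap] -[<-].
    by rewrite lt0b => /andP[].
  by move=> _ /=; case F: (s t v).2 => //; rewrite grow_reached ?F in E.
move: st1 P; rewrite /p /parent growS E; case: pickP => [i|] /=; last by rewrite E.
by case: neighbour.
Qed.

(** Parent edges are positive and the search follows every positive edge, so depth [j] in the final
    tree means reached by round [j]. *)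
Lemma chain_reached T t j v u :
    u \in C -> chain (p T) j v u -> (j <= t)%N -> (s t v).1.
Proof.
have mono t1 t2 w : (t1 <= t2)%N -> (s t1 w).1 -> (s t2 w).1.
  move=> /subnK <-; elim: (t2 - t1)%N => // d IHd /IHd h.
  by rewrite addSn grow_stable.
move=> uC vu jt; apply: mono jt _.
elim: j v vu => [|j IHj] v /=; first by move=> /eqP->.
case E: (p T v) => [w|] //= /IHj sjw.
by case: (grow_parent E) => wv gwv; apply: grow_step sjw.
Qed.

End Grow.

Section CountMark.
Variables (C : {set V}) (a : V -> option nat).
Let par := parent a.

Lemma parentP v w : par v = Some w <-> adj G v w /\ a v = Some (id w).
Proof.
rewrite /par /parent; case: (a v) => [i|] /=; last by split=> // -[].
split=> [/(neighbourP G id_inj)[vw ->]//|[vw [->]]].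
exact: neighbour_id.
Qed.

Lemma nrun_count t v :
  nrun G id (count_levels N L x) (fun v => (v \in C, a v)) t v =
  mkseq (fun j => depth_card par j v) t.+1.
Proof.
elim: t v => [|t IHt] v; first by rewrite /mkseq /= depth_card0.
rewrite nrunS IHt [RHS]mkseqS; set h := mkseq _ _.
rewrite [LHS]/= (big_neighbour G id_inj id_lt).
congr (rcons h _); rewrite depth_cardS big_mkcond [RHS]big_mkcond /=.
apply: eq_bigr => u _; rewrite IHt mkseqS last_rcons.
case: (par u =P Some v) => [/parentP[uv ->]|nuv]; first by rewrite adjC uv eqxx.
case: ifP => // vu; case: eqP => // au; case: nuv; apply/parentP.
by rewrite adjC.
Qed.

Definition cluster_radius (T : nat) (v : V) : nat :=
  radius L x (mkseq (fun j => depth_card par j v) T.+1).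

Lemma nresult_count T v :
  nresult G id (count_levels N L x) (fun v => (v \in C, a v)) T v =
  (if v \in C then Some (cluster_radius T v) else None, a v).
Proof. by rewrite /nresult nrun_count. Qed.

End CountMark.
End PhaseRuns.

Section Mark.
Variables (R : realType) (V : finType) (G : wgraph R V) (id : V -> nat).
Variables (L : nat) (C : {set V}) (a : V -> option nat) (r : V -> nat).
Local Notation par := (parent G id a).
Local Notation b := (fun v => (if v \in C then Some (r v) else None, a v)).

Hypothesis r_le : forall u, u \in C -> (r u <= L)%N.

(** A wave started in round [L - r u] is [j] levels down in round [L - r u + j]; the inequality says
    this without subtraction. *)
Lemma nrun_mark t v :
  (nrun G id (mark R L) b t v).2 = t /\
  ((nrun G id (mark R L) b t v).1 <->
   exists u j, [/\ u \in C, (L + j <= r u + t)%N & chain par j v u]).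
Proof.
elim: t v => [|t IHt] v.
  split=> //=; split=> [|[u [j [uC Lj vu]]]].
    by case: ifP => // vC Lr; exists v, 0%N; rewrite vC /= !addn0 eqxx.
  (* As radii are at most [L], only centers of radius [L] can be marked at the start. *)
  have j0 : j = 0%N by have := r_le uC; lia.
  by move: vu Lj; rewrite j0 /= => /eqP->; rewrite uC !addn0.
have [st2 st1] := IHt v; rewrite nrunS; move: st2 st1.
set st := nrun _ _ _ _ t; move=> st2 st1 /=; rewrite st2; split=> //; split.
  case/or3P => [/st1[u [j [uC Lj vu]]]||].
  - by exists u, j; split=> //; lia.
  - case E: (a v) => [i|] //; case F: neighbour => [w|] //=.
    rewrite lt0b => /(IHt w).2[u [j [uC Lj wu]]]; exists u, j.+1.
    by split; [|lia|rewrite /= /parent E /= F].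
  - by case: ifP => // vC Lr; exists v, 0%N; split; rewrite //= addn0.
move=> [u [[|j] [uC Lj vu]]].
  by move: vu Lj => /= /eqP->; rewrite uC addn0 => ->; rewrite !orbT.
move: vu; rewrite /= /parent; case E: (a v) => [i|] //=.
case F: neighbour => [w|] //= wu.
suff -> : (st w).1 by rewrite orbT.
by apply/(IHt w).2; exists u, j; split=> //; lia.
Qed.

Lemma nresult_mark v :
  nresult G id (mark R L) b L v = (v \in cluster par C r).
Proof.
apply/idP/clusterP => [/(nrun_mark L v).2|[u [j [uC jr vu]]]].
  move=> [u [j [uC jr vu]]]; exists u, j; split=> //.
  by rewrite addnC leq_add2r in jr.
by apply/(nrun_mark L v).2; exists u, j; split=> //; rewrite addnC leq_add2r.
Qed.

End Mark.

(** * Density of the marked set *)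

Section Density.
Variables (R : realType) (V : finType) (G : wgraph R V) (id : V -> nat).
Variables (N m l : nat) (D x eta : R) (o : V -> nat -> R).
Hypotheses (id_inj : injective id) (id_lt : forall v, (id v < N)%N).
Let g := oriented_by id o.
Let L := (m * l).+1.
Hypotheses (x_gt0 : 0 < x) (mx : 1 <= m%:R * x) (Vl : (#|V| <= 2 ^ l)%N).

Let C := centers G id N D o (L + L).
Let a v := (grown G id N o C L v).2.
Let par := parent G id a.
Let r := cluster_radius G id L x a L.
(** The union of the outer balls, which is output; [X] is the union of the inner balls, one level
    smaller. *)
Let S := cluster par C r.
Let X := cluster par C (fun v => (r v).-1).

Let par_center u : u \in C -> par u = None.
Proof. exact: grow_center. Qed.

Let par_adj v w : par v = Some w -> adj G v w.
Proof. by move=> /(grow_parent id_inj)[]; rewrite adjC. Qed.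

Let ball u i := (\sum_(j < i.+1) depth_card par j u)%N.

Lemma cluster_radiusP u : u \in C ->
  [/\ (0 < r u)%N, (r u <= L)%N &
      (ball u (r u))%:R <= (1 + x) * (ball u (r u).-1)%:R].
Proof.
move=> uC; rewrite /r /cluster_radius /radius.
set h := mkseq _ _.
(* The history covers levels 0 to [L], enough for the outer ball [i + 1] of each candidate
   [i < L]. *)
have hE i : (i <= L)%N -> ball_size h i = ball u i.
  move=> iL; apply: eq_bigr => j _; rewrite nth_mkseq //.
  by have := ltn_ord j; lia.
have Ph : has (fun i => (ball_size h i.+1)%:R <= (1 + x) * (ball_size h i)%:R)
              (iota 0 L).
  rewrite (@eq_in_has _ _ (fun i => (ball u i.+1)%:R <= (1 + x) * (ball u i)%:R)).
    apply: slow_growth x_gt0 mx Vl _ _.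
      by rewrite /ball big_ord1 depth_card0.
    by move=> i; apply: sum_depth_card_le; apply: par_center.
  by move=> i; rewrite mem_iota => iL; rewrite !hE //; lia.
have := nth_find 0%N Ph; move: Ph; rewrite has_find size_iota => fL.
rewrite nth_iota // add0n !hE; [by []|lia|lia].
Qed.

Hypotheses (g_or : fractional_orientation G g) (g_fair : fair G eta g).
Hypotheses (D_gt0 : 0 < D) (eta_gt0 : 0 < eta) (D_le : D <= rho_max G).

Lemma outdeg_cluster w : w \in X -> (1 - L%:R * eta) * D <= outdeg G g w.
Proof.
case/clusterP => u [j [uC jr wu]].
have [r0 rL _] := cluster_radiusP uC.
have jL : j%:R <= L%:R :> R by rewrite ler_nat; lia.
suff : (1 - j%:R * eta) * D <= outdeg G g w.
  apply: le_trans; rewrite ler_wpM2r ?(ltW D_gt0) // lerD2l lerN2.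
  by rewrite ler_wpM2r ?(ltW eta_gt0).
move: {jr jL} j w wu; elim=> [|j IHj] w /=.
  by move=> /eqP->; rewrite mul0r subr0 mul1r; apply: (centersP uC).
case E: (par w) => [w'|] //= /IHj w'D.
have [w'w gw'w] := grow_parent id_inj E.
have := g_fair w'w gw'w; move: w'D.
move: (outdeg G g w') (outdeg G g w) => y z Dy yz.
rewrite -(@ler_pM2l _ (1 + eta)); last by rewrite addr_gt0.
apply: le_trans yz; apply: le_trans Dy; rewrite mulrA ler_wpM2r ?(ltW D_gt0) //.
(* [(1 + eta) (1 - (j + 1) eta) = 1 - j eta - (j + 1) eta^2]. *)
have := mulr_ge0 (ler0n R j.+1) (sqr_ge0 eta); rewrite -natr1; nra.
Qed.

(** If [w] has depth [j], the search reaches [y] by round [j + 1], so [y] has depth at most [j + 1]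
    below some center. Both depths fit in the [2 L] rounds of the election, so that center is [u]
    itself. *)
Lemma cluster_out w y : w \in X -> adj G w y -> 0 < g w y -> y \in S.
Proof.
case/clusterP => u [j [uC jr wu]] wy gwy.
have [r0 rL _] := cluster_radiusP uC.
rewrite -ltnS prednK // in jr; have jL : (j.+1 <= L)%N := leq_trans jr rL.
have yF : (grown G id N o C j.+1 y).1.
  apply: (grow_step id_inj id_lt wy gwy).
  exact: (chain_reached id_inj id_lt uC wu).
have [i [u' [u'C ij yu']]] := grow_chain yF.
have {}yu' : chain par i y u'.
  by apply: chain_mono yu' => v' w'; apply: grow_parent_le.
have uu' : u = u'.
  apply: (centers_far id_inj id_lt par_adj uC u'C wu yu' wy).
  by rewrite -addSn leq_add // (leq_trans ij).
by apply/clusterP; exists u', i; split=> //; rewrite -uu'; apply: leq_trans ij jr.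
Qed.

(** The slow steps, summed over the disjoint balls, give [|S| <= (1 + x) |X|], while the edges
    inside [S] carry all out-degrees of [X]. *)
Lemma dense_cluster : L%:R * eta <= 1 ->
  S != set0 /\ (1 - L%:R * eta) * D <= (1 + x) * density G (induced G S).
Proof.
move=> Leta.
have XS : X \subset S.
  apply/subsetP => w /clusterP[u [j [uC jr wu]]]; apply/clusterP.
  by exists u, j; split=> //; apply: leq_trans jr (leq_pred _).
have [v Dv] := exists_outdeg_ge g_or D_gt0 D_le.
have /set0Pn[u uC] := centers_neq0 id_inj id_lt (L + L) Dv.
have S0 : S != set0.
  by apply/set0Pn; exists u; apply/clusterP; exists u, 0%N; split=> //=.
split=> //; rewrite /density mulrA ler_pdivlMr ?ltr0n ?card_gt0 //=.
have cardS : #|S|%:R <= (1 + x) * #|X|%:R.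
  rewrite /S /X !(card_cluster par_center) !natr_sum mulr_sumr.
  apply: ler_sum => u' u'C; have [r0 _] := cluster_radiusP u'C.
  by rewrite /ball prednK.
have sumX : (1 - L%:R * eta) * D * #|X|%:R <= \sum_(e in (induced G S).2) weight G e.
  apply: le_trans (sum_outdeg_le g_or XS _); last exact: cluster_out.
  rewrite -[#|X|]sum1_card natr_sum mulr_sumr; apply: ler_sum => w wX.
  by rewrite mulr1 outdeg_cluster.
apply: (@le_trans _ _ ((1 - L%:R * eta) * D * ((1 + x) * #|X|%:R))).
  by rewrite ler_wpM2l // mulr_ge0 ?subr_ge0 // ltW.
by rewrite mulrCA ler_wpM2l // addr_ge0 // ltW.
Qed.

End Density.

(** * The composed algorithm *)

Definition find_dense (R : realType) (A : program R (nat -> R))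
    (T N w L : nat) (D x : R) : program R bool :=
  to_program
    (seq_stage (of_program A) T
    (seq_stage (of_nstage w (elect N D)) (L + L)
    (seq_stage (of_nstage w (grow R N)) L
    (seq_stage (of_nstage w (count_levels N L x)) L
               (of_nstage w (mark R L)) false) false) false) false).

(** Width [w] suffices: shifted identifiers are at most [N], level counts at most [|V|], and the
    other messages are single bits. *)
Lemma result_find_dense (R : realType) (V : finType) (G : wgraph R V)
    (id : V -> nat) (A : program R (nat -> R)) (T N w L : nat) (D x : R) :
    injective id -> (forall v, (id v < N)%N) ->
    (N < 2 ^ w)%N -> (#|V| < 2 ^ w)%N -> (1 < 2 ^ w)%N ->
  let o := result G id A T in
  let C := centers G id N D o (L + L) in
  let a v := (grown G id N o C L v).2 in
  let r := cluster_radius G id L x a L in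
  (forall u, u \in C -> (r u <= L)%N) ->
  result G id (find_dense A T N w L D x) (T + (L + L + (L + (L + L)))) =
  (fun v => v \in cluster (parent G id a) C r).
Proof.
move=> id_inj id_lt Nw Vw w1 o C a r r_le.
have bw (b : bool) : (b < 2 ^ w)%N by apply: leq_trans w1; case: b.
rewrite result_to_program !sresult_seq sresult_of_program -/o.
rewrite (sresult_of_nstage (x := o)); last first.
  move=> s u i _; apply: leq_ltn_trans Nw.
  by apply: (elect_le id_inj id_lt) => v _; apply: id_lt.
have -> : nresult G id (elect N D) o (L + L) = (fun v => (o v, v \in C)).
  by apply/funext => v; apply: nresult_elect.
rewrite (sresult_of_nstage (x := fun v => (o v, v \in C))); last first.
  by move=> s u i _ /=.
rewrite (_ : nresult _ _ _ _ _ = (fun v => (v \in C, a v))) //.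
rewrite (sresult_of_nstage (x := fun v => (v \in C, a v))); last first.
  move=> s u i _ /=; case: ifP => _; last by apply: leq_trans w1.
  rewrite nrun_count // mkseqS last_rcons.
  exact: leq_ltn_trans (depth_card_le _ _ _) Vw.
rewrite (_ : nresult _ _ _ _ _ =
             (fun v => (if v \in C then Some (r v) else None, a v))); last first.
  by apply/funext => v; apply: nresult_count.
rewrite sresult_of_nstage => [|s u i _ /=] //.
by apply/funext => v; apply: nresult_mark.
Qed.

Lemma find_dense_correct (R : realType) (V : finType) (G : wgraph R V)
    (id : V -> nat) (A : program R (nat -> R)) (T N w m l : nat)
    (D x eta : R) :
    injective id -> (forall v, (id v < N)%N) ->
    (N < 2 ^ w)%N -> (#|V| < 2 ^ w)%N -> (1 < 2 ^ w)%N ->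
  let g := oriented_by id (result G id A T) in
    fractional_orientation G g -> fair G eta g ->
    0 < D -> 0 < x -> 0 < eta ->
    1 <= m%:R * x -> (#|V| <= 2 ^ l)%N -> D <= rho_max G ->
  let L := (m * l).+1 in
    L%:R * eta <= 1 ->
  let S := [set v | result G id (find_dense A T N w L D x)
                           (T + (L + L + (L + (L + L)))) v] in
  S != set0 /\ (1 - L%:R * eta) * D <= (1 + x) * density G (induced G S).
Proof.
move=> id_inj id_lt Nw Vw w1 g g_or g_fair D0 x0 eta0 mx Vl D_le L Leta S.
have [] := dense_cluster id_inj id_lt x0 mx Vl g_or g_fair D0 eta0 D_le Leta.
set S' := cluster _ _ _ => S'0 denseS'; suff -> : S = S' by [].
apply/setP => v; rewrite inE result_find_dense // => u uC.
by case: (cluster_radiusP x0 mx Vl uC).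
Qed.

(** * Logarithms and the choice of parameters *)

Lemma ltn_up_log_bound (n j : nat) : (2 <= n)%N ->
  (n ^ j < 2 ^ (j.+1 * up_log 2 n))%N.
Proof.
move=> n2; have n_le : (n <= 2 ^ up_log 2 n)%N by apply: up_logP.
have l0 : (0 < up_log 2 n)%N by rewrite up_log_gt0.
apply: (@leq_ltn_trans ((2 ^ up_log 2 n) ^ j)).
  by case: j => // j; rewrite leq_exp2r.
by rewrite -expnM ltn_exp2l // mulnC ltn_pmul2r.
Qed.

Section Log.
Variable R : realType.

Lemma log2_ge1 n : (2 <= n)%N -> 1 <= log2 R n.
Proof.
move=> n2; rewrite /log2 ler_pdivlMr ?ln_gt0 ?ltr1n // mul1r.
rewrite ler_ln ?posrE ?ltr0n ?ler_nat //.
by lia.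
Qed.

Lemma up_log_le n : (2 <= n)%N -> (up_log 2 n)%:R <= 2 * log2 R n.
Proof.
move=> n2; have := log2_ge1 n2.
suff : (up_log 2 n).-1%:R <= log2 R n.
  have : (0 < up_log 2 n)%N by rewrite up_log_gt0.
  by case: (up_log 2 n) => // l _ /=; rewrite -natr1; lra.
rewrite /log2 ler_pdivlMr ?ln_gt0 ?ltr1n // mulr_natl -lnXn ?ltr0n //.
rewrite ler_ln ?posrE ?exprn_gt0 ?ltr0n //; last by lia.
rewrite -natrX ler_nat ltnW //.
by case/andP: (up_log_bounds (isT : (1 < 2)%N) n2).
Qed.

(** This is [m * l + 1] with [m eps / 2 >= 1] and [2 ^ l >= n], as ball growth with [x = eps / 2]
    requires. *)
Definition cluster_depth (n : nat) (eps : R) : nat :=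
  ((Num.truncn (2 / eps)).+1 * up_log 2 n).+1.

Lemma truncn_inv_bound (eps : R) : 0 < eps ->
  1 <= (Num.truncn (2 / eps)).+1%:R * (eps / 2).
Proof.
move=> e0; have := ltW (truncnS_gt (2 / eps)).
by rewrite ler_pdivrMr // => h; lra.
Qed.

Lemma cluster_depth_le n (eps : R) : (2 <= n)%N -> 0 < eps -> eps < 1 ->
  (cluster_depth n eps)%:R <= 7 * (log2 R n / eps).
Proof.
move=> n2 e0 e1; have l1 := log2_ge1 n2; have ul := up_log_le n2.
have i1 : 1 <= eps^-1 by rewrite invf_ge1 // ltW.
have m_le : (Num.truncn (2 / eps)).+1%:R <= 3 / eps.
  have : (Num.truncn (2 / eps))%:R <= 2 / eps.
    by rewrite truncn_le divr_ge0 // ltW.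
  by rewrite -natr1; lra.
rewrite /cluster_depth -natr1 natrM.
(* The constant is 7 = 3 * 2 + 1, the final 1 being absorbed by [log2 R n / eps >= 1]. *)
have := ler_pM (ler0n R _) (ler0n R _) m_le ul.
have := ler_pM ler01 ler01 l1 i1; lra.
Qed.

End Log.

Definition all_ones (R : realType) : program R bool :=
  Program (fun=> tt) (fun _ _ => [::]) (fun _ _ => tt) (fun=> true).

(* [W n] is the set of admissible edge weights on n-vertex graphs (the singleton
   1 for unweighted graphs, polynomially bounded integers, ...), and identifiers
   are taken below n ^ k; both conventions are arbitrary but the same for the
   given and for the constructed algorithm.
   The hypothesis [eps <= 1 \/ 0 <= D] only excludes eps > 1 with D < 0, where
   (1 - eps) * D is positive and may exceed [rho_max G]. *)
Theorem theorem43 (R : realType) (W : nat -> R -> Prop) (k : nat)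
    (U : nat -> R -> R) :
  (exists (A : nat -> R -> program R (nat -> R)) (T : nat -> R -> nat),
    [/\ congest A,
        exists2 C : R, 0 < C &
          forall (n : nat) (eta : R), (2 <= n)%N -> 0 < eta ->
            (T n eta)%:R <= C * U n eta
      & forall (V : finType) (G : wgraph R V) (id : V -> nat) (eta : R),
          (2 <= #|V|)%N ->
          (forall e, e \in edges G -> W #|V| (weight G e)) ->
          valid_ids k id ->
          0 < eta ->
          let g := oriented_by id
                     (result G id (A #|V| eta) (T #|V| eta)) in
          fractional_orientation G g /\ fair G eta g]) ->
  exists (B : nat -> R * R -> program R bool) (T : nat -> R * R -> nat),
    [/\ congest B,
        exists2 C : R, 0 < C &
          forall (n : nat) (eps D : R), (2 <= n)%N -> 0 < eps ->
            (T n (eps, D))%:R <=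
              C * (U n (eps ^+ 2 / (128 * log2 R n))
                   + log2 R n ^+ 2 / eps ^+ 2)
      & forall (V : finType) (G : wgraph R V) (id : V -> nat) (eps D : R),
          (2 <= #|V|)%N ->
          (forall e, e \in edges G -> W #|V| (weight G e)) ->
          valid_ids k id ->
          0 < eps ->
          eps <= 1 \/ 0 <= D ->
          D <= rho_max G ->
          let S := [set v | result G id (B #|V| (eps, D))
                                   (T #|V| (eps, D)) v] in
          S != set0 /\ (1 - eps) * D <= density G (induced G S)].
Proof.
move=> [A [T [[c cA] [C C0 TC] fairA]]].
pose eta n (eps : R) := eps ^+ 2 / (128 * log2 R n).
(* In the other admissible cases [(1 - eps) * D <= 0], and the whole vertex set is a valid answer
   without communication. *)
pose hard (p : R * R) := (0 < p.2) && (p.1 < 1).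
(* Then [n ^ (k + 1) < 2 ^ w], which leaves room both for identifiers up to [n ^ k] and for counts
   up to [n]. *)
pose w n := (k.+2 * up_log 2 n)%N.
exists (fun n p =>
  if hard p then find_dense (A n (eta n p.1)) (T n (eta n p.1)) (n ^ k) (w n)
                   (cluster_depth n p.1) p.2 (p.1 / 2)
  else all_ones R).
exists (fun n p =>
  if hard p then
    let L := cluster_depth n p.1 in
    (T n (eta n p.1) + (L + L + (L + (L + L))))%N
  else 0%N).
have eta_gt0 n eps : (2 <= n)%N -> 0 < eps -> 0 < eta n eps.
  move=> n2 e0; rewrite divr_gt0 ?exprn_gt0 // mulr_gt0 //.
  by apply: lt_le_trans (log2_ge1 R n2).
split.
- exists (c + k.+2)%N => n p; case: ifP => _ //.
  have nst X Y (P : nstage R X Y) :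
      bounded ((c + k.+2) * up_log 2 n) (of_nstage (w n) P).
    by move=> s i; rewrite size_encode leq_mul2r leq_addl orbT.
  apply: bounded_seq; last by do 3![apply: bounded_seq => //].
  move=> s i; apply: leq_trans (cA _ _ _ _) _.
  by rewrite leq_mul2r leq_addr orbT.
(* Five times the depth bound [7 q] with [q = log2 R n / eps], and [q <= q ^ 2] because [q >= 1]. *)
- exists (C + 35); first by rewrite addr_gt0.
  move=> n eps D n2 e0; have TU := TC n _ n2 (eta_gt0 n eps n2 e0).
  rewrite -/(eta n eps) -expr_div_n.
  (* [C * U] bounds a number of rounds from above. *)
  have U0 : 0 <= U n (eta n eps).
    by rewrite -(pmulr_rge0 _ C0); apply: le_trans TU.
  have q0 := sqr_ge0 (log2 R n / eps).
  have CQ := mulr_ge0 (ltW C0) q0.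
  case: ifP => [/andP[_ /= e1]|_]; last by rewrite mulr_ge0 ?addr_ge0 // ltW.
  have L_le := cluster_depth_le n2 e0 e1.
  have q1 : 1 <= log2 R n / eps.
    by rewrite ler_pdivlMr // mul1r (le_trans (ltW e1)) // log2_ge1.
  rewrite !natrD; move: L_le q0 q1 CQ; set q := _ / eps => L_le q0 q1 CQ.
  have qq : q <= q ^+ 2 by rewrite expr2 ler_peMl // (le_trans ler01).
  nra.
- move=> V G id eps D n2 GW ids e0 eD D_le.
  set n := #|V| in n2 GW ids *.
  set S := [set v | _].
  case: (boolP (hard (eps, D))) => hd; last first.
    have S0 : S != set0.
      have /card_gt0P[v _] : (0 < #|V|)%N by rewrite -/n; lia.
      by apply/set0Pn; exists v; rewrite inE (negbTE hd).
    split=> //; apply: (@le_trans _ _ 0).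
      move: hd; rewrite /hard /= negb_and -!leNgt => /orP[D0|e1].
        case: eD => [e1|D1]; first by rewrite mulr_ge0_le0 // subr_ge0.
        by rewrite (_ : D = 0) ?mulr0 //; apply/eqP; rewrite eq_le D0.
      case: eD => [e2|D0]; last by rewrite mulr_le0_ge0 // subr_le0.
      by rewrite (_ : eps = 1) ?subrr ?mul0r //; apply/eqP; rewrite eq_le e2.
    rewrite divr_ge0 ?ler0n //; apply: sumr_ge0 => e; rewrite inE.
    by move=> /andP[/weight_gt0/ltW].
  have [D0 e1] : 0 < D /\ eps < 1 by apply/andP.
  have [g_or g_fair] := fairA V G id (eta n eps) n2 GW ids (eta_gt0 _ _ n2 e0).
  have [id_inj id_lt] := ids.
  have L_le := cluster_depth_le n2 e0 e1.
  have mx := truncn_inv_bound e0.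
  have Vl : (#|V| <= 2 ^ up_log 2 n)%N by apply: up_logP.
  have x0 : 0 < eps / 2 by rewrite divr_gt0.
  have eta0 := eta_gt0 _ _ n2 e0.
  (* The logarithms cancel, leaving [7 / 128 * eps]. *)
  have Leta : (cluster_depth n eps)%:R * eta n eps <= eps / 2.
    have l0 : 0 < log2 R n by apply: lt_le_trans (log2_ge1 R n2).
    apply: le_trans (ler_wpM2r (ltW eta0) L_le) _.
    have -> : 7 * (log2 R n / eps) * eta n eps = 7 / 128 * eps.
      by rewrite /eta; field; rewrite !gt_eqF.
    lra.
  have n0 : (0 < n)%N := ltnW n2.
  have big := ltn_up_log_bound k.+1 n2.
  have Nw : (n ^ k < 2 ^ w n)%N.
    by apply: leq_ltn_trans big; rewrite leq_pexp2l.
  have nw : (n < 2 ^ w n)%N.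
    by apply: leq_ltn_trans big; rewrite -[leqLHS]expn1 leq_pexp2l.
  have w1 : (1 < 2 ^ w n)%N by apply: leq_ltn_trans nw.
  have Leta1 : (cluster_depth n eps)%:R * eta n eps <= 1.
    by apply: le_trans Leta _; lra.
  have := find_dense_correct id_inj id_lt Nw nw w1 g_or g_fair D0 x0 eta0 mx Vl
    D_le Leta1.
  set S' := [set v | _] => -[S'0 denseS'].
  suff -> : S = S'.
    split=> //; rewrite -(@ler_pM2l _ (1 + eps / 2)); last by rewrite addr_gt0.
    apply: le_trans denseS'; rewrite mulrA ler_wpM2r ?(ltW D0) //.
    (* [(1 + eps / 2) (1 - eps) = 1 - eps / 2 - eps^2 / 2], which is at most [1 - L eta]. *)
    by move: Leta (sqr_ge0 eps); rewrite /cluster_depth; move: (_%:R * _) => y; nra.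
  by apply/setP => v; rewrite !inE hd.
Qed.
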